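(* Let $G=(V,E)$ be a finite simple vertex-transitive graph of order $n$ and let $v\in V$. Then for every integer $i$ with $1\le i\le n$, $$d_t(G,i)=\frac{n}{i}\,d_t^v(G,i).$$
   Context: For a finite simple graph $G=(V,E)$, a set $D\subseteq V$ is a total dominating set if every vertex of $V$ is adjacent to some vertex of $D$. $d_t(G,i)$ is the number of total dominating sets of $G$ of cardinality $i$, and $d_t^v(G,i)$ is the number of total dominating sets of $G$ of cardinality $i$ that contain the vertex $v$. *)

(* Defs.v *)
From mathcomp Require Import all_boot all_fingroup.

Set Implicit Arguments.
Unset Strict Implicit.
Unset Printing Implicit Defensive.

(* A finite simple graph is a symmetric irreflexive relation on a finType. *)
Definition simple_graph (T : finType) (e : rel T) : Prop :=
  symmetric e /\ irreflexive e.

Definition graph_automorphism (T : finType) (e : rel T) (f : {perm T}) : Prop :=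
  forall x y : T, e (f x) (f y) = e x y.

Definition vertex_transitive (T : finType) (e : rel T) : Prop :=
  forall x y : T, exists f : {perm T}, graph_automorphism e f /\ f x = y.

(* Every vertex, including those of D, must have a neighbour in D. *)
Definition total_dominating (T : finType) (e : rel T) (D : {set T}) : bool :=
  [forall x : T, exists y in D, e x y].

Definition dt (T : finType) (e : rel T) (i : nat) : nat :=
  #|[set D : {set T} | total_dominating e D & #|D| == i]|.

Definition dtv (T : finType) (e : rel T) (v : T) (i : nat) : nat :=
  #|[set D : {set T} | [&& total_dominating e D, #|D| == i & v \in D]]|.

(* Main.v *)
Require Import Defs.
From mathcomp Require Import all_boot all_fingroup all_algebra.

(** Double counting of the pairs (x, D) with D a total dominating set of
    cardinality i and x in D: summing over D gives i * dt, and summing over x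
    gives n * dtv, since automorphisms carry total dominating sets to total
    dominating sets and hence dtv does not depend on the vertex. *)

Lemma total_dominating_imset (T : finType) (e : rel T) (f : {perm T})
    (D : {set T}) :
  graph_automorphism e f -> total_dominating e D ->
  total_dominating e (f @: D).
Proof.
move=> hf /forallP hD; apply/forallP => x.
(* A neighbour in [D] of the preimage of [x] is carried by [f] to a neighbour of [x] in [f @: D]. *)
have /exists_inP[y yD exy] := hD ((f^-1)%g x).
apply/exists_inP; exists (f y); first exact: imset_f.
by rewrite -[x](permKV f) hf.
Qed.

(** Taking images under [f] is injective on sets and preserves cardinality, and it sends sets
    containing [x] to sets containing [f x]. *)
Lemma leq_dtv_automorphism (T : finType) (e : rel T) (f : {perm T}) (x : T)
    (i : nat) :
  graph_automorphism e f -> (dtv e x i <= dtv e (f x) i)%N.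
Proof.
move=> hf; rewrite /dtv -(card_imset _ (imset_inj (@perm_inj _ f))).
apply/subset_leq_card/subsetP => _ /imsetP[D + ->].
rewrite !inE => /and3P[hD cD xD].
by rewrite total_dominating_imset // card_imset ?cD ?imset_f //; apply: perm_inj.
Qed.

Lemma dtv_vertex_transitive (T : finType) (e : rel T) (x y : T) (i : nat) :
  vertex_transitive e -> dtv e x i = dtv e y i.
Proof.
(* One automorphism in each direction gives both inequalities, so [f] need not be inverted. *)
move=> hvt; have [f [hf fx]] := hvt x y; have [g [hg gy]] := hvt y x.
have := leq_dtv_automorphism _ _ _ x i hf.
have := leq_dtv_automorphism _ _ _ y i hg.
by rewrite fx gy => yx xy; apply/eqP; rewrite eqn_leq xy.
Qed.

Lemma sum_dtv (T : finType) (e : rel T) (i : nat) :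
  (\sum_(x : T) dtv e x i = dt e i * i)%N.
Proof.
rewrite /dt -sum_nat_const.
(* Membership of [x] becomes a 0/1 summand, so that the index set is independent of [x] and the sums
   can be exchanged. *)
have dtvE x : dtv e x i =
    (\sum_(D in [set D | total_dominating e D & #|D| == i]) (x \in D))%N.
  rewrite /dtv -sum1_card [RHS]big_mkcond [LHS]big_mkcond /=.
  apply: eq_bigr => D _; rewrite !inE andbA.
  by case: (x \in D); rewrite ?andbT ?andbF //; case: (_ && _).
under eq_bigr => x _ do rewrite dtvE.
rewrite exchange_big /=.
apply: eq_bigr => D; rewrite inE => /andP[_ /eqP <-].
by rewrite -big_mkcond sum1_card.
Qed.

Local Open Scope ring_scope.

Theorem lemma3p1 (T : finType) (e : rel T) (n : nat) (v : T) (i : nat)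
    (hG : simple_graph e) (hvt : vertex_transitive e) (hn : #|T| = n)
    (hi : (1 <= i <= n)%N) :
  (dt e i)%:R = n%:R / i%:R * (dtv e v i)%:R :> rat.
Proof.
have i_neq0 : i%:R != 0 :> rat.
  by rewrite Num.Theory.pnatr_eq0 -lt0n; case/andP: hi.
have count : (dt e i * i = n * dtv e v i)%N.
  rewrite -sum_dtv (eq_bigr (fun=> dtv e v i)); first by rewrite sum_nat_const hn.
  by move=> x _; apply: dtv_vertex_transitive.
by rewrite GRing.mulrAC -GRing.natrM -count GRing.natrM GRing.mulfK.
Qed.
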